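(* Let $t$ be a closed term. If $d\colon t\to_{\mathrm{cbn}}^{*} s$ and $\mathrm{normal}(s)$, then there is a tight derivation in the CbN type system of $\vdash^{(|d|_m,|d|_e)} t:\mathsf{normal}$.
   Context: Terms: $t,s ::= x \mid \lambda x.t \mid t\,s \mid t[x\leftarrow s]$, where $t[x\leftarrow s]$ (explicit substitution) binds $x$ in $t$. $\mathrm{fv}(t[x\leftarrow s])=(\mathrm{fv}(t)\setminus\{x\})\cup\mathrm{fv}(s)$; closed means no free variables; terms up to $\alpha$-equivalence. Contexts: substitution contexts $S ::= \langle\cdot\rangle \mid S[x\leftarrow t]$; CbN contexts $C ::= \langle\cdot\rangle \mid C\,t \mid C[x\leftarrow t]$; $C\langle t\rangle$ is plugging (may capture), $C\langle\langle t\rangle\rangle$ plugging where $C$ does not capture free variables of $t$. Root steps: $S\langle\lambda x.t\rangle s\mapsto_m S\langle t[x\leftarrow s]\rangle$ (variables bound by $S$ disjoint from $\mathrm{fv}(s)$); $C\langle\langle x\rangle\rangle[x\leftarrow t]\mapsto_e C\langle\langle t\rangle\rangle[x\leftarrow t]$. $\to_{m,\mathrm{cbn}}$ (resp. $\to_{e,\mathrm{cbn}}$) relates $C\langle t'\rangle$ to $C\langle s'\rangle$ for any CbN context $C$ when $t'\mapsto_m s'$ (resp. $\mapsto_e$); $\to_{\mathrm{cbn}}$ is their union. $|d|_m$, $|d|_e$ count multiplicative and exponential steps of $d$. $\mathrm{normal}$: least predicate with $\mathrm{normal}(\lambda x.t)$ and $\mathrm{normal}(t)\Rightarrow\mathrm{normal}(t[x\leftarrow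 s])$. CbN types: linear types $L ::= \mathsf{normal}\mid M\to L$; multi types $M ::= [L_i]_{i\in J}$ finite multisets, $\mathbf 0$ the empty multiset, $\uplus$ union. Type contexts $\Gamma$ map variables to multi types, all but finitely many to $\mathbf 0$; $\mathrm{dom}(\Gamma)=\{x\mid\Gamma(x)\neq\mathbf 0\}$; empty if domain empty; $\uplus$ pointwise; $\Gamma,x:M$ means $\Gamma\uplus(x\mapsto M)$ with $x\notin\mathrm{dom}(\Gamma)$; $\Gamma\setminus\!\!\setminus x$ is $\Gamma$ with $x$ mapped to $\mathbf 0$. Rules: (ax) $x:[L]\vdash^{(0,1)} x:L$; (normal) $\vdash^{(0,0)}\lambda x.t:\mathsf{normal}$; (fun) from $\Gamma\vdash^{(m,e)} t:L$ infer $\Gamma\setminus\!\!\setminus x\vdash^{(m,e)}\lambda x.t:\Gamma(x)\to L$; (many) from $\Pi_i\vdash^{(m_i,e_i)} t:L_i$ for $i\in J$ ($J$ finite, possibly empty) infer $\biguplus_i\Pi_i\vdash^{(\sum m_i,\sum e_i)} t:[L_i]_{i\in J}$; (app) from $\Gamma\vdash^{(m,e)} t:M\to L$ and $\Pi\vdash^{(m',e')} s:M$ infer $\Gamma\uplus\Pi\vdash^{(m+m'+1,e+e')} t\,s:L$; (ES) from $\Gamma,x:M\vdash^{(m,e)} t:L$ and $\Pi\vdash^{(m',e')} s:M$ infer $\Gamma\uplus\Pi\vdash^{(m+m',e+e')} t[x\leftarrow s]:L$. A derivation of $\Gamma\vdash^{(m,e)} t:L$ is tight if $L=\mathsf{normal}$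 and $\Gamma$ is empty. *)

(* Defs.v *)
From HB Require Import structures.
From mathcomp Require Import all_boot finmap multiset.

Set Implicit Arguments.
Unset Strict Implicit.
Unset Printing Implicit Defensive.

Local Open Scope fset_scope.
Local Open Scope mset_scope.
Local Open Scope nat_scope.

(* Terms up to alpha-equivalence are represented with de Bruijn indices:
   [Lam t] and [ES t s] (the explicit substitution t[x<-s]) bind index 0 in t;
   the second argument of [ES] is outside the scope of the binder. *)

Inductive term : Type :=
| Var of nat
| Lam of term
| App of term & term
| ES of term & term.

(* [fv t x] holds iff the variable of index x is free in t. *)
Fixpoint fv (t : term) (x : nat) : bool :=
  match t with
  | Var y => x == y
  | Lam u => fv u x.+1
  | App u v => fv u x || fv v x
  | ES u v => fv u x.+1 || fv v x
  end.

Definition closed (t : term) : Prop := forall x, ~~ fv t x.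

(* [lift k c t] renames the free variables of t of index >= c so that t can be
   placed under k additional binders. *)
Fixpoint lift (k c : nat) (t : term) : term :=
  match t with
  | Var y => if y < c then Var y else Var (k + y)
  | Lam u => Lam (lift k c.+1 u)
  | App u v => App (lift k c u) (lift k c v)
  | ES u v => ES (lift k c.+1 u) (lift k c v)
  end.

Inductive sctx : Type :=
| SHole
| SSub of sctx & term.

Inductive cctx : Type :=
| CHole
| CApp of cctx & term
| CSub of cctx & term.

Fixpoint splug (S : sctx) (t : term) : term :=
  match S with
  | SHole => t
  | SSub S' u => ES (splug S' t) u
  end.

Fixpoint cplug (C : cctx) (t : term) : term :=
  match C with
  | CHole => t
  | CApp C' u => App (cplug C' t) u
  | CSub C' u => ES (cplug C' t) u
  end.

(* Number of binders having the hole in their scope. *)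
Fixpoint sdepth (S : sctx) : nat :=
  match S with
  | SHole => 0
  | SSub S' _ => (sdepth S').+1
  end.

Fixpoint cdepth (C : cctx) : nat :=
  match C with
  | CHole => 0
  | CApp C' _ => cdepth C'
  | CSub C' _ => (cdepth C').+1
  end.

(* C<<t>>: the free variables of t are read outside C, and the lifting prevents
   the binders of C from capturing them. *)
Definition cplug_nc (C : cctx) (t : term) : term :=
  cplug C (lift (cdepth C) 0 t).

Inductive kind : Type := Mult | Exp.

(* In [root_m], s moves under the binders of S, hence the lifting (which plays
   the role of the disjointness of these binders from the free variables of s).
   In [root_e], C lies in the scope of the explicit substitution while t does
   not; seen from the outermost level of C, the bound variable is 0 and t is
   [lift 1 0 t]. *)
Inductive root_step : kind -> term -> term -> Prop :=
| root_m (S : sctx) (t s : term) :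
    root_step Mult (App (splug S (Lam t)) s)
                   (splug S (ES t (lift (sdepth S) 0 s)))
| root_e (C : cctx) (t : term) :
    root_step Exp (ES (cplug_nc C (Var 0)) t)
                  (ES (cplug_nc C (lift 1 0 t)) t).

Inductive cbn_step (k : kind) : term -> term -> Prop :=
| cbn_step_ctx (C : cctx) (t s : term) :
    root_step k t s -> cbn_step k (cplug C t) (cplug C s).

(* Reduction sequences of the union of the two relations, recording the kind of
   each step. *)
Inductive cbn_seq : term -> term -> Type :=
| seq_nil (t : term) : cbn_seq t t
| seq_step (k : kind) (t u s : term) :
    cbn_step k t u -> cbn_seq u s -> cbn_seq t s.

Fixpoint mult_length (t s : term) (d : cbn_seq t s) : nat :=
  match d with
  | seq_nil _ => 0
  | seq_step k _ _ _ _ d' =>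
      (if k is Mult then 1 else 0) + mult_length d'
  end.

Fixpoint exp_length (t s : term) (d : cbn_seq t s) : nat :=
  match d with
  | seq_nil _ => 0
  | seq_step k _ _ _ _ d' =>
      (if k is Exp then 1 else 0) + exp_length d'
  end.

Inductive normal : term -> Prop :=
| normal_lam (t : term) : normal (Lam t)
| normal_es (t s : term) : normal t -> normal (ES t s).

(* The grammar L ::= normal | M -> L, with M a finite multiset of linear types,
   is a nested inductive type through the quotient [{mset _}], which Rocq does
   not accept.  It is obtained from raw types, where sequences replace
   multisets, by keeping one canonical representative for each raw type up to
   reordering at every depth.  The facts [LNormal_neq_LArr], [LArr_inj] and
   [ltype_ind] show that [ltype] is freely generated by [LNormal] and
   [LArr : {mset ltype} -> ltype -> ltype]. *)

Inductive raw : Type :=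
| RNormal
| RArr of seq raw & raw.

Definition raw_nested_ind (P : raw -> Prop) (PN : P RNormal)
    (PA : forall s r, foldr (fun x Q => P x /\ Q) True s -> P r ->
       P (RArr s r)) : forall r, P r :=
  fix rec r : P r :=
    match r with
    | RNormal => PN
    | RArr s r' =>
        PA s r' ((fix all_rec s : foldr (fun x Q => P x /\ Q) True s :=
             match s with
             | [::] => I
             | x :: s' => conj (rec x) (all_rec s')
             end) s) (rec r')
    end.

Fixpoint raw_encode (r : raw) : GenTree.tree unit :=
  match r with
  | RNormal => GenTree.Leaf tt
  | RArr s r' => GenTree.Node 0 (raw_encode r' :: map raw_encode s)
  end.

Fixpoint raw_decode (t : GenTree.tree unit) : raw :=
  match t with
  | GenTree.Node _ (t' :: ts) => RArr (map raw_decode ts) (raw_decode t')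
  | _ => RNormal
  end.

Lemma raw_encodeK : cancel raw_encode raw_decode.
Proof.
elim/raw_nested_ind => //= s r IHs ->; congr RArr.
by elim: s IHs => //= x s IH [-> /IH ->].
Qed.

HB.instance Definition _ := Countable.copy raw (can_type raw_encodeK).

(* [enum_mset A] depends only on the multiset A: it provides a canonical
   ordering of its elements. *)
Fixpoint canon (r : raw) : raw :=
  match r with
  | RNormal => RNormal
  | RArr s r' => RArr (enum_mset (seq_mset (map canon s))) (canon r')
  end.

Record ltype : Type := LType { lraw :> raw; _ : canon lraw == lraw }.

HB.instance Definition _ := [isSub for lraw].
HB.instance Definition _ := [Countable of ltype by <:].

Notation mtype := {mset ltype}.

Lemma lrawK (L : ltype) : canon (lraw L) = lraw L.
Proof. by case: L => r /= /eqP. Qed.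

Definition LNormal : ltype := @LType RNormal (eqxx _).

Fact LArr_subproof (M : mtype) (L : ltype) :
  let r := RArr (enum_mset (seq_mset (map lraw (enum_mset M)))) (lraw L) in
  canon r == r.
Proof.
rewrite /= lrawK; apply/eqP; congr RArr; congr enum_mset.
set E := enum_mset (seq_mset _).
suff -> : map canon E = E by rewrite /E seq_mset_id.
apply: map_id_in => x.
by rewrite (perm_mem (perm_eq_seq_mset _)) => /mapP[y _ ->]; rewrite lrawK.
Qed.

Definition LArr (M : mtype) (L : ltype) : ltype := LType (LArr_subproof M L).

Lemma LNormal_neq_LArr (M : mtype) (L : ltype) : LNormal <> LArr M L.
Proof. by move/(congr1 lraw). Qed.

Lemma LArr_inj (M M' : mtype) (L L' : ltype) :
  LArr M L = LArr M' L' -> M = M' /\ L = L'.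
Proof.
move/(congr1 lraw) => /= [eM /val_inj ->]; split=> //.
have eq_perm : perm_eq (map lraw (enum_mset M)) (map lraw (enum_mset M')).
  have := perm_eq_seq_mset (map lraw (enum_mset M)).
  by rewrite eM perm_sym => /perm_trans; apply; apply: perm_eq_seq_mset.
rewrite -(seq_mset_id M) -(seq_mset_id M'); apply/eq_seq_msetP.
exact: (perm_map_inj val_inj eq_perm).
Qed.

Lemma ltype_ind (P : ltype -> Prop) :
  P LNormal ->
  (forall (M : mtype) (L : ltype),
     (forall L', L' \in M -> P L') -> P L -> P (LArr M L)) ->
  forall L, P L.
Proof.
move=> PN PA [r cr]; elim/raw_nested_ind: r cr => [|s r IHs IHr] cr.
  by rewrite (_ : LType cr = LNormal) //; apply: val_inj.
have := cr; rewrite /= => /eqP[es er].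
have cs x : x \in s -> canon x == x.
  have IH y : canon (canon y) = canon y.
    elim/raw_nested_ind: y => //= s' r' IH ->; congr RArr; congr enum_mset.
    set E := enum_mset (seq_mset _).
    suff -> : map canon E = E by rewrite /E seq_mset_id.
    apply: map_id_in => y; rewrite (perm_mem (perm_eq_seq_mset _)).
    elim: s' IH {E} => //= z s' IHs' [ez /IHs' es'].
    by rewrite inE => /orP[/eqP->|/es'].
  rewrite -{1}es (perm_mem (perm_eq_seq_mset _)) => /mapP[y _ ->].
  by rewrite IH.
have crr : canon r == r by apply/eqP.
have [l el] : exists l : seq ltype, map lraw l = s.
  elim: (s) cs => [|x s' IH] cs; first by exists [::].
  case: IH => [y ys|l <-]; first by apply: cs; rewrite inE ys orbT.
  have cx : canon x == x by apply: cs; rewrite mem_head.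
  by exists (LType cx :: l).
have -> : LType cr = LArr (seq_mset l) (LType crr).
  apply: val_inj => /=; congr RArr.
  rewrite -{1}es; congr enum_mset; apply/eq_seq_msetP.
  have -> : map canon s = s by apply: map_id_in => x /cs/eqP.
  by rewrite -{1}el perm_map // perm_sym perm_eq_seq_mset.
apply: PA => [L'|]; last exact: IHr.
rewrite (perm_mem (perm_eq_seq_mset _)) => L'l.
have : lraw L' \in s by rewrite -el map_f.
move=> /[dup] L's; elim: (s) IHs => //= x s' IH [Px /IH IHs'].
rewrite inE => /orP[/eqP ex|/IHs' //].
have cx : canon x == x by rewrite -ex lrawK.
by rewrite (_ : L' = LType cx) //; apply: val_inj.
Qed.

Definition tctx := {fsfun nat -> mtype with mset0}.

Definition dom (G : tctx) : {fset nat} := finsupp G.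

Definition tctx0 : tctx := [fsfun].

Definition tctx_single (x : nat) (M : mtype) : tctx :=
  [fsfun y in [fset x] => M].

Definition tctxU (G D : tctx) : tctx :=
  [fsfun x in (dom G `|` dom D)%fset => G x `+` D x].

(* The context of a binder's body is seen from outside the binder by removing
   index 0 and decrementing the others: [tctx_tail G] is the counterpart of
   "G \\ x" for the variable x bound by index 0, and [tctx_cons M G] that of
   "G, x : M", where G does not mention x. *)
Definition tctx_tail (G : tctx) : tctx :=
  [fsfun x in [fset y.-1 | y in dom G] => G x.+1].

Definition tctx_cons (M : mtype) (G : tctx) : tctx :=
  [fsfun x in (0 |` [fset y.+1 | y in dom G])%fset => if x is y.+1 then G y else M].

Lemma tctx0E x : tctx0 x = mset0.
Proof. by rewrite fsfunE. Qed.

Lemma tctx_singleE x M y :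
  tctx_single x M y = if y == x then M else mset0.
Proof. by rewrite fsfunE inE. Qed.

Lemma tctxUE G D x : tctxU G D x = G x `+` D x.
Proof.
rewrite fsfunE inE; case: ifPn => //; rewrite negb_or => /andP[xG xD].
by rewrite !fsfun_dflt // mset0D.
Qed.

Lemma tctx_tailE G x : tctx_tail G x = G x.+1.
Proof.
rewrite fsfunE; case: ifPn => // xG; rewrite fsfun_dflt //.
by apply: contra xG => xG; apply/imfsetP; exists x.+1.
Qed.

Lemma tctx_consE M G x :
  tctx_cons M G x = if x is y.+1 then G y else M.
Proof.
rewrite fsfunE; case: ifPn => //; case: x => [|x]; first by rewrite !inE.
rewrite !inE /= => xG; rewrite fsfun_dflt //.
by apply: contra xG => xG; apply/imfsetP; exists x.
Qed.

(* [lderiv G m e t L] is the type of derivations of G |-(m,e) t : L, and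
   [mderiv G m e t M] that of derivations of G |-(m,e) t : M. *)

Inductive lderiv : tctx -> nat -> nat -> term -> ltype -> Type :=
| d_ax (x : nat) (L : ltype) :
    lderiv (tctx_single x [mset L]) 0 1 (Var x) L
| d_normal (t : term) :
    lderiv tctx0 0 0 (Lam t) LNormal
| d_fun (G : tctx) (m e : nat) (t : term) (L : ltype) :
    lderiv G m e t L ->
    lderiv (tctx_tail G) m e (Lam t) (LArr (G 0) L)
| d_app (G P : tctx) (m e m' e' : nat) (t s : term) (M : mtype) (L : ltype) :
    lderiv G m e t (LArr M L) ->
    mderiv P m' e' s M ->
    lderiv (tctxU G P) (m + m' + 1) (e + e') (App t s) L
| d_es (G P : tctx) (m e m' e' : nat) (t s : term) (M : mtype) (L : ltype) :
    lderiv (tctx_cons M G) m e t L ->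
    mderiv P m' e' s M ->
    lderiv (tctxU G P) (m + m') (e + e') (ES t s) L
with mderiv : tctx -> nat -> nat -> term -> mtype -> Type :=
| d_many (J : finType) (P : J -> tctx) (m e : J -> nat) (t : term)
    (L : J -> ltype) :
    (forall i : J, lderiv (P i) (m i) (e i) t (L i)) ->
    mderiv (\big[tctxU/tctx0]_(i : J) P i)
           (\sum_(i : J) m i) (\sum_(i : J) e i)
           t (seq_mset [seq L i | i : J]).

Definition tight (G : tctx) (m e : nat) (t : term) (L : ltype)
    (D : lderiv G m e t L) : Prop :=
  L = LNormal /\ dom G = fset0.

(* Main.v *)
From HB Require Import structures.
From mathcomp Require Import all_boot finmap multiset zify.
Require Import Defs.

Set Implicit Arguments.
Unset Strict Implicit.
Unset Printing Implicit Defensive.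

Local Open Scope fset_scope.
Local Open Scope mset_scope.
Local Open Scope nat_scope.

(* Subject expansion with exact counting: if t -> u is a step of kind k, every
   derivation of u yields one of t with the same context and type, whose index
   for k is larger by one.  Since the hole of a CbN context is never in argument
   position, it is typed by exactly one linear derivation.  Hence, for an
   exponential step, the copy of the substituted term is typed once, with some
   L'; replacing this subderivation by an axiom for L' adds 1 to the exponential
   index, and the subderivation joins those of the argument of the explicit
   substitution.  Normal terms are tightly typable with indices (0, 0). *)

(** * Algebra of type contexts: the commutative monoid of unions, and deletion of an index *)

Lemma tctxUC : commutative tctxU.
Proof. by move=> G D; apply/fsfunP => x; rewrite !tctxUE msetDC. Qed.

Lemma tctxUA : associative tctxU.
Proof. by move=> G D E; apply/fsfunP => x; rewrite !tctxUE msetDA. Qed.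

Lemma tctxU0l : left_id tctx0 tctxU.
Proof. by move=> G; apply/fsfunP => x; rewrite tctxUE tctx0E mset0D. Qed.

HB.instance Definition _ := Monoid.isComLaw.Build tctx tctx0 tctxU
  tctxUA tctxUC tctxU0l.

Lemma tctxU0r : right_id tctx0 tctxU.
Proof. exact: Monoid.mulm1. Qed.

Lemma tctx_cons_tail (G : tctx) : tctx_cons (G 0) (tctx_tail G) = G.
Proof. by apply/fsfunP => -[|x]; rewrite tctx_consE ?tctx_tailE. Qed.

Lemma tctx_tail_cons M G : tctx_tail (tctx_cons M G) = G.
Proof. by apply/fsfunP => x; rewrite tctx_tailE tctx_consE. Qed.

Lemma tctx_tailU G D :
  tctx_tail (tctxU G D) = tctxU (tctx_tail G) (tctx_tail D).
Proof. by apply/fsfunP => x; rewrite !(tctx_tailE, tctxUE). Qed.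

(** Used when [P] types a lifted term: such a term cannot mention the bound variable, so the rest
    [D] accounts for all of [M]. *)
Lemma tctx_cons_eqU M G P D : tctx_cons M G = tctxU P D -> P 0 = mset0 ->
  M = D 0 /\ G = tctxU (tctx_tail P) (tctx_tail D).
Proof.
move=> EG P0; split; last by rewrite -tctx_tailU -EG tctx_tail_cons.
by have := congr1 (fun H : tctx => H 0) EG; rewrite tctx_consE tctxUE P0 mset0D.
Qed.

Lemma tctx_cons0 : tctx_cons mset0 tctx0 = tctx0.
Proof. by apply/fsfunP => -[|x]; rewrite tctx_consE !tctx0E. Qed.

(** Undoes on contexts the renaming [bump c] that [lift 1 c] performs on variables; the entry at [c]
    is dropped. *)
Definition tctx_del (c : nat) (G : tctx) : tctx :=
  [fsfun x in [fset unbump c y | y in dom G] => G (bump c x)].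

Lemma tctx_delE c (G : tctx) x : tctx_del c G x = G (bump c x).
Proof.
rewrite fsfunE; case: ifPn => // xG; rewrite fsfun_dflt //.
by apply: contra xG => xG; apply/imfsetP; exists (bump c x); rewrite ?bumpK.
Qed.

Lemma tctx_del_0 G : tctx_del 0 G = tctx_tail G.
Proof. by apply/fsfunP => x; rewrite tctx_delE tctx_tailE. Qed.

Lemma tctx_del0 c : tctx_del c tctx0 = tctx0.
Proof. by apply/fsfunP => x; rewrite tctx_delE !tctx0E. Qed.

Lemma tctx_delU c G D :
  tctx_del c (tctxU G D) = tctxU (tctx_del c G) (tctx_del c D).
Proof. by apply/fsfunP => x; rewrite !(tctx_delE, tctxUE). Qed.

Lemma tctx_del_single c x M :
  tctx_del c (tctx_single (bump c x) M) = tctx_single x M.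
Proof.
apply/fsfunP => y; rewrite tctx_delE !tctx_singleE.
by rewrite (inj_eq (can_inj (@bumpK c))).
Qed.

Lemma tctx_del_tail c G :
  tctx_del c (tctx_tail G) = tctx_tail (tctx_del c.+1 G).
Proof. by apply/fsfunP => x; rewrite !(tctx_delE, tctx_tailE) bumpS. Qed.

Lemma tctx_del_cons c M G :
  tctx_del c.+1 (tctx_cons M G) = tctx_cons M (tctx_del c G).
Proof.
apply/fsfunP => -[|x]; rewrite tctx_delE; first by rewrite !tctx_consE.
by rewrite bumpS !tctx_consE tctx_delE.
Qed.

(** * Building and inverting derivations *)

Lemma lderiv_cast G G' m m' e e' t L :
  lderiv G m e t L -> G = G' -> m = m' -> e = e' -> lderiv G' m' e' t L.
Proof. by move=> D <- <- <-. Qed.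

Lemma mderiv_cast G G' m m' e e' t M M' :
  mderiv G m e t M -> G = G' -> m = m' -> e = e' -> M = M' ->
  mderiv G' m' e' t M'.
Proof. by move=> D <- <- <- <-. Qed.

Lemma mderiv0 t : mderiv tctx0 0 0 t mset0.
Proof.
(* Rule (many) without premises; [LNormal] is a dummy, as [void] has no element. *)
have D (i : void) : lderiv tctx0 0 0 t LNormal by case: i.
apply: mderiv_cast (d_many D) _ _ _ _; rewrite ?big1 //.
apply/msetP => L; rewrite mset0E mset_seqE /image_mem.
by case: (enum _) => [|[]].
Qed.

Lemma enum_option (J : finType) :
  enum {: option J} = None :: map Some (enum J).
Proof. by rewrite !enumT [in LHS]unlock. Qed.

Lemma big_option_fin (J : finType) R (idx : R) (op : Monoid.com_law idx)
    (F : option J -> R) :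
  \big[op/idx]_(i : option J) F i =
    op (F None) (\big[op/idx]_(j : J) F (Some j)).
Proof. by rewrite -big_enum enum_option big_cons big_map big_enum. Qed.

Lemma mderivD1 G P m e m' e' t L M :
  lderiv G m e t L -> mderiv P m' e' t M ->
  mderiv (tctxU G P) (m + m') (e + e') t (L +` M).
Proof.
move=> + Ds; case: Ds => J Pi mi ei {}t Li Di D.
(* The index set grows to [option J], with [None] indexing the added derivation. *)
pose ext (A : Type) (a : A) (f : J -> A) i := oapp f a i.
apply: (mderiv_cast (@d_many (option J) (ext _ G Pi) (ext _ m mi)
  (ext _ e ei) t (ext _ L Li) _)); rewrite ?big_option_fin //.
- by case.
- by rewrite /image_mem enum_option /= mset_cons -map_comp.
Qed.

(** Context and counters are indices, so that case analysis substitutes them in the goal. *)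
Variant app_inv t s L : tctx -> nat -> nat -> Type :=
| AppInv G P m e m' e' M : lderiv G m e t (LArr M L) -> mderiv P m' e' s M ->
    app_inv t s L (tctxU G P) (m + m' + 1) (e + e').

Lemma lderiv_appP G m e t s L : lderiv G m e (App t s) L -> app_inv t s L G m e.
Proof.
move Eu: (App t s) => u D; case: D Eu => //.
by move=> {}G P {}m {}e m' e' t1 s1 M {}L D1 D2 [-> ->]; apply: AppInv D1 D2.
Qed.

Variant es_inv t s L : tctx -> nat -> nat -> Type :=
| ESInv G P m e m' e' M :
    lderiv (tctx_cons M G) m e t L -> mderiv P m' e' s M ->
    es_inv t s L (tctxU G P) (m + m') (e + e').

Lemma lderiv_esP G m e t s L : lderiv G m e (ES t s) L -> es_inv t s L G m e.
Proof.
move Eu: (ES t s) => u D; case: D Eu => //.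
by move=> {}G P {}m {}e m' e' t1 s1 M {}L D1 D2 [-> ->]; apply: ESInv D1 D2.
Qed.

(** * Lifting and strengthening *)

Lemma lift0 c t : lift 0 c t = t.
Proof.
elim: t c => [x|t IH|t IHt s IHs|t IHt s IHs] c /=; rewrite ?IH ?IHt ?IHs //.
by case: ifP.
Qed.

Lemma lift_lift1 k c t : lift k c (lift 1 c t) = lift k.+1 c t.
Proof.
elim: t c => [x|t IH|t IHt s IHs|t IHt s IHs] c /=; rewrite ?IH ?IHt ?IHs //.
case: ifP => /= [->//|xc]; case: ifP => [|_]; first lia.
by congr Var; lia.
Qed.

(** The linear case is a hypothesis, so that this lemma can serve within the induction proving that
    case. *)
Lemma mderiv_unlift c t :
  (forall G m e L, lderiv G m e (lift 1 c t) L ->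
     (G c = mset0) * lderiv (tctx_del c G) m e t L) ->
  forall G m e M, mderiv G m e (lift 1 c t) M ->
     (G c = mset0) * mderiv (tctx_del c G) m e t M.
Proof.
move=> IH G m e M; move Eu: (lift 1 c t) => u D; case: D Eu.
move=> J P mi ei {}u L D Eu; rewrite -{}Eu in D; split.
  apply: (big_ind (fun G : tctx => G c = mset0)) => [|G1 G2 G1c G2c|i _].
  - exact: tctx0E.
  - by rewrite tctxUE G1c G2c mset0D.
  - exact: (IH _ _ _ _ (D i)).1.
apply: (mderiv_cast (d_many (fun i => (IH _ _ _ _ (D i)).2))) => //.
by rewrite (big_morph _ (tctx_delU c) (tctx_del0 c)).
Qed.

(** There is no weakening: contexts record only variables typed by axioms, and [c] does not occur in
    a lifted term. *)
Lemma lderiv_unlift c t G m e L : lderiv G m e (lift 1 c t) L ->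
  (G c = mset0) * lderiv (tctx_del c G) m e t L.
Proof.
elim: t c G m e L => [x|t IH|t IHt s IHs|t IHt s IHs] c G m e L /=.
- have -> : (if x < c then Var x else Var (1 + x)) = Var (bump c x).
    by rewrite /bump ltnNge; case: (c <= x).
  move Eu: (Var _) => u D; case: D Eu => // _ {}L [<-].
  rewrite tctx_del_single tctx_singleE (negPf (neq_bump _ _)).
  by split=> //; apply: d_ax.
- move Eu: (Lam _) => u D.
  case: D Eu => [//|_ _|{}G {}m {}e u' {}L D [Eu]|//|//].
    by rewrite tctx0E tctx_del0; split=> //; apply: d_normal.
  rewrite -{}Eu in D; have [Gc {}D] := IH _ _ _ _ _ D.
  rewrite tctx_tailE tctx_del_tail; split=> //.
  (* As [bump c.+1 0] is 0, deletion keeps the multi type of the bound variable, hence the arrow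
     type. *)
  by have := d_fun D; rewrite tctx_delE.
- case/lderiv_appP => {}G P {}m {}e m' e' M /IHt[Gc Dt].
  case/(mderiv_unlift (IHs c)) => Pc Ds.
  rewrite tctxUE Gc Pc mset0D tctx_delU; split=> //; exact: d_app Dt Ds.
- case/lderiv_esP => {}G P {}m {}e m' e' M /IHt[].
  rewrite tctx_consE tctx_del_cons => Gc Dt.
  case/(mderiv_unlift (IHs c)) => Pc Ds.
  rewrite tctxUE Gc Pc mset0D tctx_delU; split=> //; exact: d_es Dt Ds.
Qed.

(** * Expansion of root steps *)

(** For an empty [S], rule (ES) is traded for (fun) and (app), the latter counting 1. Otherwise the
    derivation of [s] ignores the outer binder of [S] and moves out of its scope. *)
Lemma root_m_expansion S t s G m e L :
  lderiv G m e (splug S (ES t (lift (sdepth S) 0 s))) L ->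
  lderiv G m.+1 e (App (splug S (Lam t)) s) L.
Proof.
elim: S s G m e L => [|S IH u] s G m e L /=.
  rewrite lift0 => /lderiv_esP[{}G P {}m {}e m' e' M /d_fun].
  rewrite tctx_tail_cons tctx_consE => Dt Ds.
  by apply: lderiv_cast (d_app Dt Ds) _ _ _ => //; lia.
(* One lifting is split off, so the induction hypothesis applies to [lift 1 0 s]. *)
case/lderiv_esP => {}G P {}m {}e m' e' M; rewrite -lift_lift1 => /IH D Du.
move EG: (tctx_cons M G) D => G' D; move Em: m.+1 D => m1 D.
case/lderiv_appP: D EG Em => G1 P1 {}m1 {}e m1' e1' N Dt.
case/(mderiv_unlift (@lderiv_unlift 0 s)) => P10.
rewrite tctx_del_0 => Ds; rewrite tctxUC => EG Em.
have {EG}[EM EG] := tctx_cons_eqU EG P10.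
rewrite -(tctx_cons_tail G1) -EM in Dt.
apply: lderiv_cast (d_app (d_es Dt Du) Ds) _ _ _; try lia.
by rewrite EG tctxUC tctxUA.
Qed.

(** Isolates the single derivation of the term in the hole. The variable [x] is arbitrary because
    its index shifts under the binders of [C]. *)
Variant hole_split C t : tctx -> nat -> nat -> ltype -> Type :=
| HoleSplit P G m' e' m e L' L :
    lderiv P m' e' t L' ->
    (forall x, lderiv (tctxU (tctx_single x [mset L']) G) m e.+1
                 (cplug_nc C (Var x)) L) ->
    hole_split C t (tctxU P G) (m' + m) (e' + e) L.

Lemma hole_split_cast C t G G' m m' e e' L :
  hole_split C t G m e L -> G = G' -> m = m' -> e = e' ->
  hole_split C t G' m' e' L.
Proof. by move=> D <- <- <-. Qed.

Lemma cplug_nc_CSub C u t :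
  cplug_nc (CSub C u) t = ES (cplug_nc C (lift 1 0 t)) u.
Proof. by rewrite /cplug_nc lift_lift1. Qed.

Lemma hole_splitP C t G m e L :
  lderiv G m e (cplug_nc C t) L -> hole_split C t G m e L.
Proof.
elim: C t G m e L => [|C IH u|C IH u] t G m e L.
(* The whole derivation sits in the hole: the remainder is empty and an axiom types the variable. *)
- rewrite {1}/cplug_nc /= lift0 => D.
  apply: hole_split_cast (@HoleSplit CHole t _ tctx0 _ _ 0 0 _ L D _) _ _ _;
    rewrite ?tctxU0r ?addn0 //.
  by move=> x; rewrite tctxU0r /cplug_nc lift0; apply: d_ax.
- case/lderiv_appP => {}G P {}m {}e m' e' M D Du.
  move EL: (LArr M L) D => L1 /IH D.
  case: D EL => P1 G1 m1' e1' m1 e1 L' {}L1 Dt DC EL.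
  apply: hole_split_cast (@HoleSplit _ _ _ (tctxU G1 P) _ _
    (m1 + m' + 1) (e1 + e') _ _ Dt _) _ _ _; rewrite ?tctxUA //; try lia.
  by move=> x; have := DC x; rewrite -EL tctxUA => D; apply: d_app D Du.
- rewrite cplug_nc_CSub => /lderiv_esP[{}G P {}m {}e m' e' M].
  move EG: (tctx_cons M G) => G' /IH D.
  case: D EG => P1 G1 m1' e1' m1 e1 L' {}L /lderiv_unlift[P10].
  rewrite tctx_del_0 => Dt DC EG Du.
  have {EG}[EM EG] := tctx_cons_eqU EG P10.
  apply: hole_split_cast (@HoleSplit _ _ _ (tctxU (tctx_tail G1) P) _ _
    (m1 + m') (e1 + e') _ _ Dt _) _ _ _; rewrite ?EG ?tctxUA //; try lia.
  move=> x; rewrite cplug_nc_CSub tctxUA -addSn; apply: d_es Du.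
  (* The outer [x] is [x.+1] under the binder, so the new axiom leaves index 0 with multi type
     [M]. *)
  apply: lderiv_cast (DC x.+1) _ _ _ => //; rewrite EM.
  by apply/fsfunP => -[|y];
    rewrite tctx_consE !tctxUE !tctx_singleE ?mset0D // tctx_tailE.
Qed.

Lemma root_e_expansion C t G m e L :
  lderiv G m e (ES (cplug_nc C (lift 1 0 t)) t) L ->
  lderiv G m e.+1 (ES (cplug_nc C (Var 0)) t) L.
Proof.
case/lderiv_esP => {}G P {}m {}e m' e' M.
move EG: (tctx_cons M G) => G' /hole_splitP D.
case: D EG => P1 G1 m1' e1' m1 e1 L' {}L /lderiv_unlift[P10].
rewrite tctx_del_0 => Dt /(_ 0) DC EG Ds.
have {EG}[EM EG] := tctx_cons_eqU EG P10.
(* The hole now holds the variable bound by the substitution, whose multi type gains [L']. *)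
have {}DC : lderiv (tctx_cons (L' +` M) (tctx_tail G1)) m1 e1.+1
    (cplug_nc C (Var 0)) L.
  apply: lderiv_cast DC _ _ _ => //; rewrite EM.
  by apply/fsfunP => -[|y];
    rewrite tctx_consE !tctxUE !tctx_singleE ?mset0D // tctx_tailE.
apply: lderiv_cast (d_es DC (mderivD1 Dt Ds)) _ _ _; try lia.
by rewrite EG tctxUA (tctxUC (tctx_tail G1)).
Qed.

(** * Closure under contexts and reduction sequences *)

(** [inhabited] is needed because steps live in [Prop] and derivations in [Type]. *)
Lemma cbn_step_expansion k t u G m e L : cbn_step k t u ->
  inhabited (lderiv G m e u L) ->
  inhabited (lderiv G ((if k is Mult then 1 else 0) + m)
                      ((if k is Exp then 1 else 0) + e) t L).
Proof.
case=> C {}t {}u tu [D].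
elim: C G m e L D => [|C IH s|C IH s] G m e L /=.
- by case: tu => [S {}t s /root_m_expansion|{}C {}t /root_e_expansion] D;
    constructor.
- case/lderiv_appP => {}G P {}m {}e m' e' M /IH[D] Ds; constructor.
  by apply: lderiv_cast (d_app D Ds) _ _ _; rewrite ?addnA.
- case/lderiv_esP => {}G P {}m {}e m' e' M /IH[D] Ds; constructor.
  by apply: lderiv_cast (d_es D Ds) _ _ _; rewrite ?addnA.
Qed.

Lemma normal_lderiv t : normal t -> inhabited (lderiv tctx0 0 0 t LNormal).
Proof.
elim=> [{}t|{}t s _ [D]]; constructor; first exact: d_normal.
(* The bound variable gets [mset0], so the argument is typed zero times, at no cost. *)
rewrite -tctx_cons0 in D.
by apply: lderiv_cast (d_es D (mderiv0 s)) _ _ _; rewrite ?tctxU0l.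
Qed.

Theorem theorem2 (t s : term) (d : cbn_seq t s) :
  closed t -> normal s ->
  exists D : lderiv tctx0 (mult_length d) (exp_length d) t LNormal, tight D.
Proof.
move=> _ s_normal.
suff [D] : inhabited (lderiv tctx0 (mult_length d) (exp_length d) t LNormal).
  by exists D; split=> //; apply: finsupp0.
elim: d s_normal => [u|k {}t u {}s tu d IH] s_normal /=.
  exact: normal_lderiv.
exact: cbn_step_expansion tu (IH s_normal).
Qed.
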